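(* Let $A$ be a metrizable abelian topological group. Then $\hat A$ is a $k$-space.
   Context: $\mathbb{T}=\mathbb{R}/\mathbb{Z}$. $\hat A$ is the group of continuous homomorphisms $A\to\mathbb{T}$ with the compact-open topology. A Hausdorff space $X$ is a $k$-space if a subset $F\subseteq X$ is closed whenever $F\cap K$ is closed in $K$ for every compact $K\subseteq X$. *)

(* Defs.v *)
From HB Require Import structures.
From mathcomp Require Import all_boot all_order all_algebra generic_quotient.
From mathcomp Require Import all_classical all_reals all_analysis.
Set Implicit Arguments. Unset Strict Implicit. Unset Printing Implicit Defensive.
Import Order.TTheory GRing.Theory Num.Theory numFieldTopology.Exports.
Local Open Scope classical_set_scope.
Local Open Scope ring_scope.
Local Open Scope quotient_scope.

Definition modZ (R : realType) : rel R := fun x y => (x - y) \is a Num.int.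

Lemma modZ_refl (R : realType) : reflexive (@modZ R).
Proof. by move=> x; rewrite /modZ subrr rpred0. Qed.

Lemma modZ_sym (R : realType) : symmetric (@modZ R).
Proof. by move=> x y; rewrite /modZ -opprB rpredN. Qed.

Lemma modZ_trans (R : realType) : transitive (@modZ R).
Proof.
move=> y x z Hxy Hyz; rewrite /modZ.
by rewrite -[x - z](subrKA y) rpredD.
Qed.

Definition modZ_equiv (R : realType) : equiv_rel R :=
  EquivRel (@modZ R) (@modZ_refl R) (@modZ_sym R) (@modZ_trans R).

Definition circle (R : realType) : Type :=
  quotient_topology {eq_quot (modZ_equiv R)}.
HB.instance Definition _ (R : realType) :=
  Quotient.copy (circle R) (quotient_topology {eq_quot (modZ_equiv R)}).
HB.instance Definition _ (R : realType) :=
  Topological.copy (circle R) (quotient_topology {eq_quot (modZ_equiv R)}).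

Definition circle_add (R : realType) (a b : circle R) : circle R :=
  \pi_(circle R) (repr a + repr b).

Definition metrizable (R : realType) (X : topologicalType) : Prop :=
  exists d : X -> X -> R,
    [/\ forall x y, 0 <= d x y,
        forall x y, d x y = 0 <-> x = y,
        forall x y, d x y = d y x,
        forall x y z, d x z <= d x y + d y z &
        forall (x : X) (U : set X),
          nbhs x U <-> exists2 e : R, 0 < e & [set y | d x y < e] `<=` U].

Definition dual_set (R : realType) (A : topologicalZmodType) :
    set {compact-open, A -> circle R} :=
  [set f | continuous (f : A -> circle R) /\
           forall x y : A, f (x + y) = circle_add (f x) (f y)].

Definition dual (R : realType) (A : topologicalZmodType) : Type :=
  set_type (@dual_set R A).
HB.instance Definition _ (R : realType) (A : topologicalZmodType) :=
  Topological.copy (dual R A) (set_type (@dual_set R A)).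

Definition k_space (X : topologicalType) : Prop :=
  hausdorff_space X /\
  forall F : set X,
    (forall K : set X, compact K ->
       closed ((@set_val X K) @^-1` F : set (set_type K))) ->
    closed F.

(* Main.v *)
(** The argument is of Banach-Dieudonné type.  Let [F] have compactly closed
    traces and let [f] be a character outside [F].  Call polar of [S] the set of
    characters within [1/4] of [f] on [S].  Polars of neighbourhoods of [0] are
    compact (equicontinuity), they exhaust the dual, and the polar of the whole
    group is [{f}].  Along a decreasing base [U n] of neighbourhoods of [0] with
    [U 0] the whole group, compactness yields growing finite sets [S n], whose
    new points are taken from [U n], such that the polar of [S n `|` U n] misses
    [F].  The union [K] of all [S n] and [{0}] converges to [0], so its polar is
    a neighbourhood of [f], and it misses [F]. *)

Require Import Defs.
From HB Require Import structures.
From mathcomp Require Import all_boot all_order all_algebra generic_quotient.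
From mathcomp Require Import all_classical all_reals all_analysis.
From mathcomp Require Import lra zify.
Set Implicit Arguments. Unset Strict Implicit. Unset Printing Implicit Defensive.
Import Order.TTheory GRing.Theory Num.Theory numFieldTopology.Exports.
Import numFieldNormedType.Exports.
Local Open Scope classical_set_scope.
Local Open Scope ring_scope.
Local Open Scope quotient_scope.

(** * Distance from a real number to the nearest integer *)

Section DistanceToIntegers.
Variable R : realType.
Implicit Types s t u c : R.

(** The invariant norm of [R/Z], read on real representatives; the nearest integer is the floor or
    its successor. *)
Definition distZ t : R :=
  Num.min (t - (Num.floor t)%:~R) ((Num.floor t + 1)%:~R - t).

Lemma distZ_ge0 t : 0 <= distZ t.
Proof.
by rewrite le_min !subr_ge0 Num.Theory.floor_le ltW // Num.Theory.floorD1_gt.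
Qed.

Lemma distZ_le t (m : int) : distZ t <= `|t - m%:~R|.
Proof.
rewrite ge_min; have /andP[h1 h2] := Num.Theory.floor_itv t.
have [mf|mf] := leP m (Num.floor t).
  apply/orP; left; rewrite -(ler_int R) in mf.
  by rewrite ger0_norm; lra.
apply/orP; right; rewrite -lezD1 -(ler_int R) in mf.
by rewrite ler0_norm; lra.
Qed.

Lemma distZ_attained t : exists m : int, distZ t = `|t - m%:~R|.
Proof.
have /andP[h1 h2] := Num.Theory.floor_itv t; rewrite /distZ.
case: leP => _.
  by exists (Num.floor t); rewrite ger0_norm //; lra.
by exists (Num.floor t + 1); rewrite ler0_norm; lra.
Qed.

Lemma distZ_le_norm t : distZ t <= `|t|.
Proof. by have := distZ_le t 0; rewrite subr0. Qed.

Lemma distZD s t : distZ (s + t) <= distZ s + distZ t.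
Proof.
have [m ->] := distZ_attained s; have [n ->] := distZ_attained t.
apply: le_trans (distZ_le _ (m + n)) (le_trans _ (ler_normD _ _)).
by rewrite intrD opprD addrACA.
Qed.

Lemma distZDz s (m : int) : distZ (s + m%:~R) = distZ s.
Proof.
have h u (n : int) : distZ (u + n%:~R) <= distZ u.
  have [k ->] := distZ_attained u; apply: le_trans (distZ_le _ (k + n)) _.
  by rewrite intrD (_ : _ - _ = u - k%:~R) //; lra.
apply/le_anti; rewrite h /=.
by have := h (s + m%:~R) (- m); rewrite mulrNz addrK.
Qed.

Lemma distZN s : distZ (- s) = distZ s.
Proof.
have h u : distZ (- u) <= distZ u.
  have [k ->] := distZ_attained u; apply: le_trans (distZ_le _ (- k)) _.
  by rewrite mulrNz -opprD normrN.
by apply/le_anti; rewrite h /= -{1}(opprK s) h.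
Qed.

Lemma distZC s t : distZ (s - t) = distZ (t - s).
Proof. by rewrite -distZN opprB. Qed.

Lemma distZ_triangle t s u : distZ (s - u) <= distZ (s - t) + distZ (t - u).
Proof. by rewrite -(subrKA t) distZD. Qed.

Lemma distZ0 : distZ 0 = 0.
Proof. by apply/le_anti; rewrite distZ_ge0 -{2}(normr0 R) distZ_le_norm. Qed.

Lemma distZ_eq0 t : distZ t <= 0 -> exists m : int, t = m%:~R.
Proof.
move=> t0; have [m tm] := distZ_attained t; exists m.
by apply/eqP; rewrite -subr_eq0 -normr_le0 -tm.
Qed.

(** If [m] and [n] are nearest to [t] and [t + t], then [n - 2m] is at most [3c <= 3/4] in absolute
    value, so it vanishes and the bound on [t + t] can be halved. Iterated along doublings, this
    turns the bound 1/4 into arbitrarily small ones. *)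
Lemma distZ_halve t c : c <= 4^-1 -> distZ t <= c -> distZ (t + t) <= c ->
  distZ t <= c / 2.
Proof.
move=> c4; have [m ->] := distZ_attained t; have [n ->] := distZ_attained (t + t).
rewrite !ler_norml => /andP[h1 h2] /andP[h3 h4].
(* The integer nearest to [t + t] is twice the one nearest to [t]. *)
have : `|(n - (m + m))%:~R : R| < 1.
  by rewrite !intrD mulrNz intrD ltr_norml; apply/andP; split; lra.
rewrite -intr_norm -[1]/(1%:~R) ltr_int => hn.
have e : n = m + m by apply/eqP; rewrite -subr_eq0; lia.
by move: h3 h4; rewrite e intrD => h3 h4; apply/andP; split; lra.
Qed.

End DistanceToIntegers.

(** * The quotient topology of the circle in terms of [distZ] *)

Section Circle.
Variable R : realType.
Implicit Types a b : circle R.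

Lemma circle_pi_eq (x y : R) :
  \pi_(circle R) x = \pi_(circle R) y <-> exists m : int, x = y + m%:~R.
Proof.
have -> : (\pi_(circle R) x = \pi_(circle R) y) <-> (x - y) \is a Num.int.
  change ((\pi_(circle R) x = \pi_(circle R) y) <-> modZ_equiv R x y).
  rewrite -eqmodE.
  by split=> [h|/eqP//]; apply/eqP.
split=> [/intrP[m e]|[m ->]]; last by rewrite addrAC subrr add0r intr_int.
by exists m; rewrite -e addrC subrK.
Qed.

Lemma circle_repr_pi (x : R) :
  exists m : int, repr (\pi_(circle R) x) = x + m%:~R.
Proof. by apply/circle_pi_eq; rewrite reprK. Qed.

Lemma circle_open_ball (c : R) (e : R) :
  open [set b : circle R | distZ (repr b - c) < e].
Proof.
(* Openness in the quotient is openness of the preimage in [R]. *)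
rewrite -[open _]/(open (_ : set R)) openE => x /= hx.
have [m em] := circle_repr_pi x; move: hx; rewrite /= em addrAC distZDz => hx.
rewrite /interior; apply/nbhs_ballP.
exists (e - distZ (x - c)) => [|y]; first by rewrite /= subr_gt0.
rewrite /ball/= => hy; have [n ->] := circle_repr_pi y.
rewrite addrAC distZDz; apply: le_lt_trans (distZ_triangle x _ _) _.
rewrite -ltrBrDr; apply: le_lt_trans hy; rewrite distrC; exact: distZ_le_norm.
Qed.

(** Together with [circle_open_ball], this makes the [distZ] balls a base of neighbourhoods. *)
Lemma circle_nbhs a (U : set (circle R)) : nbhs a U ->
  exists2 e : R, 0 < e & forall b, distZ (repr b - repr a) < e -> U b.
Proof.
rewrite nbhsE => -[B [oB Ba] BU].
have : nbhs (repr a) (\pi_(circle R) @^-1` B).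
  apply: open_nbhs_nbhs; split; first exact: oB.
  by rewrite /= reprK.
move=> /nbhs_ballP[e /= e0 he]; exists e => // b.
have [m ->] := distZ_attained (repr b - repr a) => hb; apply: BU.
(* Subtracting the integer nearest to [repr b - repr a] gives a representative of [b] that is close
   to [repr a] in [R]. *)
have -> : b = \pi_(circle R) (repr b - m%:~R).
  rewrite -[LHS]reprK; apply/circle_pi_eq; exists m; by rewrite subrK.
apply: he; rewrite /ball /= distrC (_ : _ - _ = repr b - repr a - m%:~R) //.
by rewrite addrAC.
Qed.

End Circle.

Lemma quarter_expr_small (R : realType) (e : R) : 0 < e ->
  exists k : nat, 4^-1 / 2 ^+ k < e.
Proof.
move=> e0; have e1 : 0 <= e^-1 by rewrite invr_ge0 ltW.
exists (Num.Def.archi_bound e^-1); set n := Num.Def.archi_bound _.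
rewrite ltr_pdivrMr ?exprn_gt0 // mulrC -ltr_pdivrMr //.
have h1 : e^-1 < n%:R := Num.Theory.archi_boundP e1.
have h2 : n%:R < 2 ^+ n :> R by rewrite -natrX ltr_nat ltn_expl.
have : 4^-1 / e <= e^-1 by rewrite ler_piMl //; lra.
lra.
Qed.

Lemma nbhs_subr (A : topologicalZmodType) (x : A) (V : set A) :
  nbhs 0 V -> nbhs x [set y | V (y - x)].
Proof.
rewrite -{1}(subrr x) -[x - x]/((x, - x).1 + (x, - x).2).
move=> /(@add_continuous A)[[B C] /= [B0 C0] BC].
apply: filterS B0 => y By; apply: (BC (y, - x)); split=> //=.
exact: nbhs_singleton C0.
Qed.

(** * Characters through their real lifts *)

Section Characters.
Variables (R : realType) (A : topologicalZmodType).
Implicit Types (f g : dual R A) (h : A -> R).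

Definition char_fun f : A -> circle R := \val f.

Lemma char_fun_continuous f : continuous (char_fun f).
Proof. by have [] := set_valP f. Qed.

Lemma char_funD f x y :
  char_fun f (x + y) = circle_add (char_fun f x) (char_fun f y).
Proof. by have [_] := set_valP f; apply. Qed.

Definition lift_char f (x : A) : R := repr (char_fun f x).

(** What remains of a homomorphism into [R/Z] after lifting it to [R]. Differences and pointwise
    limits of lifts keep this property, and they can be computed in [R]. *)
Definition additive_modZ h :=
  forall x y, exists m : int, h (x + y) = h x + h y + m%:~R.

Lemma lift_char_additive f : additive_modZ (lift_char f).
Proof.
move=> x y; rewrite /lift_char char_funD.
exact: circle_repr_pi.
Qed.

Lemma additive_modZB h1 h2 : additive_modZ h1 -> additive_modZ h2 ->
  additive_modZ (fun x => h1 x - h2 x).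
Proof.
move=> a1 a2 x y; have [m ->] := a1 x y; have [n ->] := a2 x y.
by exists (m - n); rewrite intrD mulrNz; lra.
Qed.

Lemma additive_modZ_distZ h : additive_modZ h ->
  forall x y, distZ (h (x + y)) = distZ (h x + h y).
Proof. by move=> ha x y; have [m ->] := ha x y; rewrite distZDz. Qed.

Lemma additive_modZ_sub h : additive_modZ h ->
  forall x y, distZ (h y - h x) = distZ (h (y - x)).
Proof.
move=> ha x y; have [m] := ha (y - x) x; rewrite subrK => ->.
have -> : h (y - x) + h x + m%:~R - h x = h (y - x) + m%:~R by lra.
by rewrite distZDz.
Qed.

(** The set [W] does not depend on [h]: this is the source of equicontinuity. Asking that both [x]
    and [x + x] lie in the previous [W] halves the bound, by [distZ_halve]. *)
Lemma additive_modZ_small (U : set A) (k : nat) : nbhs 0 U ->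
  exists2 W, nbhs 0 W & forall h, additive_modZ h ->
    (forall x, U x -> distZ (h x) <= 4^-1) ->
    forall x, W x -> distZ (h x) <= 4^-1 / 2 ^+ k.
Proof.
move=> U0; elim: k => [|k [W W0 IH]].
  by exists U => // h _ hU x /hU; rewrite expr0 divr1.
exists (W `&` [set x | W (x + x)]).
  apply: filterI => //.
  have : nbhs (0 + 0 : A) W by rewrite addr0.
  move=> /(@add_continuous A (0, 0))[[B C] /= [B0 C0] BC].
  apply: filterS (filterI B0 C0) => x [Bx Cx]; exact: (BC (x, x)).
move=> h ha hU x [Wx W2x]; rewrite exprSr invfM mulrA; apply: distZ_halve.
- rewrite ler_pdivrMr ?exprn_gt0 // ler_peMr ?invr_ge0 //.
  by apply: exprn_ege1; lra.
- exact: IH.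
- by rewrite -additive_modZ_distZ //; exact: IH.
Qed.

(** The circle has no small subgroups: the bound also holds at [x + x], so it can be halved
    forever. *)
Lemma additive_modZ_trivial h : additive_modZ h ->
  (forall x, distZ (h x) <= 4^-1) -> forall x, distZ (h x) <= 0.
Proof.
move=> ha h4 x; apply/ler_addgt0Pr => e e0; rewrite add0r.
suff H k : forall y, distZ (h y) <= 4^-1 / 2 ^+ k.
  by have [k /ltW] := quarter_expr_small e0; exact: le_trans.
elim: k => [|k IH] y; first by rewrite expr0 divr1.
rewrite exprSr invfM mulrA; apply: distZ_halve => //.
- rewrite ler_pdivrMr ?exprn_gt0 // ler_peMr ?invr_ge0 //.
  by apply: exprn_ege1; lra.
- by rewrite -additive_modZ_distZ.
Qed.

Lemma lift_char_nbhs0 f (e : R) : 0 < e ->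
  nbhs 0 [set x | distZ (lift_char f x) < e].
Proof.
move=> e0.
have d0 : distZ (lift_char f 0) = 0.
  have [m] := lift_char_additive f 0 0; rewrite addr0 => hm.
  have -> : lift_char f 0 = 0 + (- m)%:~R by rewrite mulrNz; lra.
  by rewrite distZDz distZ0.
have h : nbhs (0 : A) (char_fun f @^-1` [set b | distZ (repr b - 0) < e]).
  apply: char_fun_continuous; apply: open_nbhs_nbhs.
  split; first exact: circle_open_ball.
  by rewrite /= subr0 -[repr _]/(lift_char f 0) d0.
by apply: filterS h => x /=; rewrite subr0.
Qed.

(** Continuity at [0] spreads to every point by translation, since [h y - h x] and [h (y - x)] agree
    modulo integers. *)
Lemma additive_modZ_char h : additive_modZ h ->
  (forall e : R, 0 < e -> nbhs 0 [set x | distZ (h x) < e]) ->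
  exists f, forall x, char_fun f x = \pi_(circle R) (h x).
Proof.
move=> ha h0.
suff hf : @dual_set R A (fun x => \pi_(circle R) (h x)).
  by exists (SigSub (mem_set hf)).
split=> [x U /circle_nbhs[e e0 eU]|x y]; last first.
  apply/circle_pi_eq; have [m ->] := ha x y.
  have [n ->] := circle_repr_pi (h x); have [p ->] := circle_repr_pi (h y).
  by exists (m - n - p); rewrite !intrD !mulrNz; lra.
rewrite nbhs_simpl /=; apply: filterS (nbhs_subr x (h0 e e0)) => y /= hy.
apply: eU.
have [n ->] := circle_repr_pi (h x); have [p ->] := circle_repr_pi (h y).
have -> : h y + p%:~R - (h x + n%:~R) = h y - h x + (p - n)%:~R.
  by rewrite intrD mulrNz; lra.
by rewrite distZDz additive_modZ_sub.
Qed.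

End Characters.

(** * General facts on compactness and filters *)

Section Topology.

(** A filter on [K] that does not cluster at [p] contains some [K] minus a neighbourhood of [p],
    which is finite and hence compact. *)
Lemma null_family_compact (T : topologicalType) (p : T) (K : set T) : K p ->
  (forall V, nbhs p V -> finite_set (K `\` V)) -> compact K.
Proof.
move=> Kp Kfin F FF FK; have [cp|ncp] := pselect (cluster F p).
  by exists p.
have [G FG [V pV GV]] : exists2 G, F G & exists2 V, nbhs p V & G `&` V = set0.
  apply: contra_notP ncp => H G V FG pV; apply/set0P/negP => /eqP GV.
  by apply: H; exists G => //; exists V.
have FKV : F (K `\` V).
  apply: filterS (filterI FG FK) => x [Gx Kx]; split=> // Vx.
  by have : (G `&` V) x by []; rewrite GV.
have [x [[Kx _] cx]] := finite_compact (Kfin V pV) FF FKV.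
by exists x.
Qed.

Lemma compact_finite_subcover (T : topologicalType) (I : choiceType) (K : set T)
    (D : set I) (O : I -> set T) : compact K ->
  (forall i, D i -> open (O i)) -> K `<=` \bigcup_(i in D) O i ->
  exists E : set I, [/\ finite_set E, E `<=` D & K `<=` \bigcup_(i in E) O i].
Proof.
move=> Kc Oo KO; have [[t Kt]|K0] := pselect (K !=set0); last first.
  exists set0; split=> // x Kx; exfalso; apply: K0; by exists x.
(* A point of [K] serves as base point, as the cover form of compactness expects a pointed space. *)
pose X : ptopologicalType := HB.pack T (isPointed.Build T t).
have : cover_compact (K : set X) by rewrite -compact_cover.
move=> /(_ I D O Oo KO)[E ED KE]; eexists; split; [exact: finite_fset| |exact: KE].
by move=> i /ED; rewrite inE.
Qed.

Lemma filter_finite_forall (T : Type) (I : choiceType) (F : set_system T)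
    (D : set I) (P : I -> T -> Prop) : Filter F -> finite_set D ->
  (forall i, D i -> F (P i)) -> F [set t | forall i, D i -> P i t].
Proof.
move=> FF /finite_fsetP[E ->] H.
by apply: filterS (filter_bigI FF H) => t Pt i; exact: Pt.
Qed.

(** The image of an ultrafilter converges to each of its cluster points, and compactness provides
    one. *)
Lemma ultra_map_cvg (S : Type) (T : topologicalType) (F : set_system S)
    (h : S -> T) (K : set T) : UltraFilter F -> compact K ->
  F (h @^-1` K) -> exists2 p, K p & forall U, nbhs p U -> F (h @^-1` U).
Proof.
move=> FU Kc FK; have [p [Kp cp]] := Kc (h @ F) _ FK.
exists p => // U pU; have [//|FnU] := in_ultra_setVsetC (h @^-1` U) FU.
by have [y [/= nUy Uy]] := cp (~` U) U FnU pU.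
Qed.

(** Passes from the subspace condition in [k_space] to the ambient space: the trace of [F] is [K]
    minus an open set. *)
Lemma compact_subtype_closed (T : topologicalType) (K F : set T) : compact K ->
  closed (@set_val T K @^-1` F : set (set_type K)) -> compact (K `&` F).
Proof.
move=> Kc; rewrite -openC => -[B Bo BF].
have -> : K `&` F = K `&` ~` B.
  apply/seteqP; split=> x [Kx Fx]; split=> //.
    move=> Bx; pose y : set_type K := SigSub (mem_set Kx).
    have : (@set_val T K @^-1` B) y by [].
    by rewrite BF; apply.
  apply: contrapT => nFx; apply: Fx; pose y : set_type K := SigSub (mem_set Kx).
  have : (~` (@set_val T K @^-1` F)) y by [].
  by rewrite -BF.
by apply: compact_closedI => //; rewrite closedC.
Qed.

End Topology.

(** * The compact-open topology on the dual, and polars *)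

Section DualTopology.
Variables (R : realType) (A : topologicalZmodType).
Implicit Types f g : dual R A.

Lemma dual_nbhs_compact_open f (K : set A) (O : set (circle R)) :
  compact K -> open O -> (forall x, K x -> O (char_fun f x)) ->
  nbhs f [set g | forall x, K x -> O (char_fun g x)].
Proof.
move=> Kc Oo KO; apply: open_nbhs_nbhs; split=> //.
exists [set g : {compact-open, A -> circle R} | g @` K `<=` O].
  exact: compact_open_open.
apply/seteqP; split=> g /= h.
  by move=> x Kx; apply: h; exists x.
by move=> _ [x Kx <-]; exact: h.
Qed.

Lemma dual_cvg (F : set_system (dual R A)) f : Filter F ->
  (forall K O, compact K -> open O -> (forall x, K x -> O (char_fun f x)) ->
    F [set g | forall x, K x -> O (char_fun g x)]) -> F --> f.
Proof.
move=> FF H U /=; rewrite nbhs_simpl nbhsE /= => -[B [[C Co <-] Cf] CU].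
have cv : (@set_val _ (@dual_set R A)) @ F -->
    (char_fun f : {compact-open, A -> circle R}).
  apply/compact_open_cvgP => K O Kc Oo KO.
  have HF := H K O Kc Oo; rewrite nbhs_simpl /=; apply: filterS (HF _).
    by move=> g /= hg _ [x Kx <-]; exact: hg.
  by move=> x Kx; apply: KO; exists x.
have : nbhs (char_fun f : {compact-open, A -> circle R}) C.
  exact: open_nbhs_nbhs.
move=> /cv hC; have {}hC : F (@set_val _ (@dual_set R A) @^-1` C) := hC.
exact: filterS hC.
Qed.

Lemma dual_nbhs_point f (x : A) (e : R) : 0 < e ->
  nbhs f [set g | distZ (lift_char g x - lift_char f x) < e].
Proof.
move=> e0; have := @dual_nbhs_compact_open f [set x]
  [set b | distZ (repr b - lift_char f x) < e] (@compact_set1 _ x).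
move=> /(_ (@circle_open_ball R _ e)) H; apply: filterS (H _).
  by move=> g /= /(_ x erefl).
by move=> _ -> /=; rewrite subrr distZ0.
Qed.

Lemma char_ext f g :
  (forall x, distZ (lift_char f x - lift_char g x) <= 0) -> f = g.
Proof.
move=> h; apply: val_inj; apply/funext => x.
have [m hm] := distZ_eq0 (h x).
rewrite -[LHS]/(char_fun f x) -[RHS]/(char_fun g x).
rewrite -[LHS]reprK -[RHS]reprK; apply/circle_pi_eq; exists m.
by rewrite -hm addrC subrK.
Qed.

Lemma dual_hausdorff : hausdorff_space (dual R A).
Proof.
move=> f g cfg; apply: char_ext => x; apply/ler_addgt0Pr => e e0; rewrite add0r.
have e2 : 0 < e / 2 by lra.
have [k [/= kf kg]] := cfg _ _ (dual_nbhs_point f x e2) (dual_nbhs_point g x e2).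
apply: le_trans (distZ_triangle (lift_char k x) _ _) _.
by rewrite distZC; lra.
Qed.

(** The usual polar of [S], translated by [f]. The constant 1/4 is the largest one that
    [distZ_halve] accepts. *)
Definition polar f (S : set A) : set (dual R A) :=
  [set g | forall x, S x -> distZ (lift_char g x - lift_char f x) <= 4^-1].

Lemma polar_setT f : polar f setT = [set f].
Proof.
apply/seteqP; split=> [g gf|_ ->] /=; last first.
  by move=> x _; rewrite subrr distZ0 invr_ge0.
apply: char_ext => x.
apply: (@additive_modZ_trivial R A (fun x => lift_char g x - lift_char f x)).
  by apply: additive_modZB; exact: lift_char_additive.
by move=> y; exact: gf.
Qed.

Lemma polar_point_open f x :
  open [set g | 4^-1 < distZ (lift_char g x - lift_char f x)].
Proof.
rewrite openE => g /= hg; rewrite /interior.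
have e0 : 0 < distZ (lift_char g x - lift_char f x) - 4^-1 by lra.
apply: filterS (dual_nbhs_point g x e0) => k /= hk.
have := distZ_triangle (lift_char k x) (lift_char g x) (lift_char f x).
by rewrite (distZC _ (lift_char k x)); lra.
Qed.

(** [h - lift_char f] is uniformly small near [0] by [additive_modZ_small], and [f] is continuous.
    Stating this for real functions lets it apply to a pointwise limit not yet known to be a
    character. *)
Lemma polar_equicontinuous f (U : set A) (e : R) : nbhs 0 U -> 0 < e ->
  nbhs 0 [set x | forall h : A -> R, additive_modZ h ->
    (forall y, U y -> distZ (h y - lift_char f y) <= 4^-1) -> distZ (h x) < e].
Proof.
move=> U0 e0; have e2 : 0 < e / 2 by lra.
have [k ke] := quarter_expr_small e2.
have [W W0 HW] := @additive_modZ_small R A U k U0.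
apply: filterS (filterI W0 (lift_char_nbhs0 f e2)) => x [Wx /= fx] h ha hU.
have := HW _ (additive_modZB ha (lift_char_additive f)) hU x Wx.
have := distZD (h x - lift_char f x) (lift_char f x); rewrite subrK; lra.
Qed.

(** An Ascoli argument: an ultrafilter on the polar converges pointwise, and equicontinuity makes
    the limit a character and the convergence uniform on compact sets. *)
Lemma polar_compact f (U : set A) : nbhs 0 U -> compact (polar f U).
Proof.
move=> U0; rewrite compact_ultra => F FU FP /=.
have lim x : exists t : R, forall e : R, 0 < e ->
    F [set g | distZ (lift_char g x - t) < e].
  (* Fractional parts stay in the compact segment from 0 to 1, where the ultrafilter has a limit. *)
  pose fr (g : dual R A) : R := lift_char g x - (Num.floor (lift_char g x))%:~R.
  have frI : F (fr @^-1` `[0, 1]).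
    apply: filterS (filterT : F setT) => g _; rewrite /fr /= in_itv /=.
    have := Num.Theory.floor_itv (lift_char g x); rewrite intrD => /andP[h1 h2].
    by apply/andP; split; lra.
  have [t _ ht] := ultra_map_cvg FU (@segment_compact R 0 1) frI.
  exists t => e e0; have := ht _ (nbhsx_ballx t e e0); apply: filterS => g.
  rewrite /ball /= distrC => hg; apply: le_lt_trans hg.
  apply: le_trans (distZ_le _ (Num.floor (lift_char g x))) _.
  by rewrite /fr addrAC.
have [h hlim] := choice lim.
have ha : additive_modZ h.
  (* The defect has [distZ] below every [e]: compare with a [g] that is [e / 3]-close to [h] at [x],
     [y] and [x + y]. *)
  move=> x y; have [m hm] : exists m : int, h (x + y) - (h x + h y) = m%:~R.
    apply: distZ_eq0; apply/ler_addgt0Pr => e e0; rewrite add0r.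
    have e3 : 0 < e / 3 by lra.
    have [g [[gx gy] gxy]] := filter_ex
      (filterI (filterI (hlim x _ e3) (hlim y _ e3)) (hlim (x + y) _ e3)).
    have [m hm] := lift_char_additive g x y.
    have -> : h (x + y) - (h x + h y) =
      - (lift_char g (x + y) - h (x + y))
      + ((lift_char g x - h x) + (lift_char g y - h y)) + m%:~R.
      by rewrite hm; lra.
    rewrite distZDz; apply: le_trans (distZD _ _) _; rewrite distZN.
    have := distZD (lift_char g x - h x) (lift_char g y - h y).
    by move: gx gy gxy => /=; lra.
  by exists m; rewrite -hm; lra.
have hU x : U x -> distZ (h x - lift_char f x) <= 4^-1.
  move=> Ux; apply/ler_addgt0Pr => e e0.
  have [g [gP gx]] := filter_ex (filterI FP (hlim x _ e0)).
  have := distZ_triangle (lift_char g x) (h x) (lift_char f x).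
  by have := gP x Ux; move: gx; rewrite /= (distZC _ (h x)); lra.
have [|g gh] := @additive_modZ_char R A h ha.
  move=> e e0; apply: filterS (polar_equicontinuous f U0 e0) => x; exact.
have glift x : exists m : int, lift_char g x = h x + m%:~R.
  by rewrite /lift_char gh; exact: circle_repr_pi.
exists g; split.
  move=> x Ux; have [m ->] := glift x.
  by rewrite addrAC distZDz; exact: hU.
apply: dual_cvg => K O Kc Oo KO.
(* By compactness it is enough to control [k y] for [y] near a fixed [x] and [k] far along the
   filter: [e / 2] comes from equicontinuity between [y] and [x], and [e / 2] from pointwise
   convergence at [x]. *)
have [/(_ Kc) H _] := @compact_near_coveringP A K.
apply: (H _ F (fun k x => O (char_fun k x))) => x Kx.
have [e e0 eO] := circle_nbhs (open_nbhs_nbhs (conj Oo (KO x Kx))).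
have e2 : 0 < e / 2 by lra.
exists ([set y | forall k : A -> R, additive_modZ k ->
    (forall z, U z -> distZ (k z - lift_char f z) <= 4^-1) ->
    distZ (k (y - x)) < e / 2],
  polar f U `&` [set k | distZ (lift_char k x - h x) < e / 2]).
  split=> /=; first exact: nbhs_subr (polar_equicontinuous f U0 e2).
  by apply: filterI => //; exact: hlim.
move=> [y k] /= [hy [kP kx]]; apply: eO.
rewrite -[repr (char_fun k y)]/(lift_char k y) -[repr (char_fun g x)]/(lift_char g x).
have [m ->] := glift x; rewrite opprD addrA -mulrNz distZDz.
apply: le_lt_trans (distZ_triangle (lift_char k x) _ _) _.
rewrite additive_modZ_sub; last exact: lift_char_additive.
by have := hy _ (lift_char_additive k) kP; lra.
Qed.

End DualTopology.

(** * The Banach-Dieudonné construction *)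

Section BanachDieudonne.
Variables (R : realType) (A : topologicalZmodType).
Implicit Types f g : dual R A.

(** The compact set [polar f V] intersected with [F] is covered by the open conditions violating the
    polar at a point of [S] or [U]; a finite subcover names the points of [E]. *)
Lemma polar_finite_step f (F : set (dual R A)) (S U V : set A) :
  (forall K, compact K -> closed (@set_val _ K @^-1` F : set (set_type K))) ->
  nbhs 0 V -> polar f (S `|` U) `&` F = set0 ->
  exists E : set A, [/\ finite_set E, E `<=` S `|` U &
    polar f (E `|` V) `&` F = set0].
Proof.
move=> Fk V0 SUF; have PV := @polar_compact R A f V V0.
have PVF := compact_subtype_closed PV (Fk _ PV).
have [|E [Efin ESU HE]] := compact_finite_subcover PVF
    (fun x (_ : (S `|` U) x) => polar_point_open f x).
  move=> g [gV gF]; apply: contrapT => H.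
  suff : (polar f (S `|` U) `&` F) g by rewrite SUF.
  split=> // x xSU; rewrite leNgt; apply/negP => hx; apply: H.
  by exists x.
exists E; split=> //; apply/seteqP; split=> // g [gEV gF].
have [|x Ex /=] := HE g; last by rewrite ltNge gEV //; left.
by split=> // x Vx; apply: gEV; right.
Qed.

(** Where [f] is below 1/8, [K] is compact and a compact-open condition keeps [g] below 1/8 too, for
    a total of 1/4. The finitely many other points are handled one by one. *)
Lemma polar_null_nbhs f (K : set A) : K 0 ->
  (forall V, nbhs 0 V -> finite_set (K `\` V)) -> nbhs f (polar f K).
Proof.
move=> K0 Kfin; have e8 : (0 : R) < 8^-1 by rewrite invr_gt0.
pose V := [set x | distZ (lift_char f x) < 8^-1].
have V0 : nbhs 0 V := lift_char_nbhs0 f e8.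
have KVc : compact (K `&` V).
  apply: (@null_family_compact _ 0); first by split=> //; exact: nbhs_singleton V0.
  by move=> W /Kfin; apply: sub_finite_set => x [[Kx _] nWx].
have N1 : nbhs f [set g | forall x, (K `&` V) x ->
    distZ (lift_char g x - 0) < 8^-1].
  apply: (@dual_nbhs_compact_open R A f _ _ KVc (@circle_open_ball R 0 8^-1)).
  by move=> x [_ Vx] /=; rewrite subr0.
have N2 : nbhs f [set g | forall x, (K `\` V) x ->
    distZ (lift_char g x - lift_char f x) <= 4^-1].
  have e4 : (0 : R) < 4^-1 by rewrite invr_gt0.
  apply: filter_finite_forall (Kfin V V0) _ => x _.
  by apply: filterS (dual_nbhs_point f x e4) => g /ltW.
apply: filterS (filterI N1 N2) => g [/= g1 g2] x Kx.
have [Vx|nVx] := pselect (V x); last exact: g2.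
have := g1 x (conj Kx Vx); rewrite subr0 => h1.
have := distZD (lift_char g x) (- lift_char f x); rewrite distZN.
by move: Vx; rewrite /V /=; lra.
Qed.

Lemma char_in_polar f g (U : nat -> set A) :
  (forall V, nbhs 0 V -> exists n, U n `<=` V) -> exists n, polar f (U n) g.
Proof.
move=> Ubase; have e8 : (0 : R) < 8^-1 by rewrite invr_gt0.
have [n Un] := Ubase _ (filterI (lift_char_nbhs0 f e8) (lift_char_nbhs0 g e8)).
exists n => x /Un [/= h1 h2].
by have := distZD (lift_char g x) (- lift_char f x); rewrite distZN; lra.
Qed.

Lemma compactly_closed_nbhs f (F : set (dual R A)) (U : nat -> set A) :
  U 0%N = setT -> (forall n, nbhs 0 (U n)) -> (forall n, U n.+1 `<=` U n) ->
  (forall V, nbhs 0 V -> exists n, U n `<=` V) ->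
  (forall K, compact K -> closed (@set_val _ K @^-1` F : set (set_type K))) ->
  ~ F f -> nbhs f (~` F).
Proof.
move=> U0 Unbhs Udec Ubase Fk nFf.
(* The hypothesis sits under the existential so that [choice] gives a total step function; [set0] is
   a dummy value. *)
have ex_step (p : nat * set A) : exists E : set A,
    polar f (p.2 `|` U p.1) `&` F = set0 ->
    [/\ finite_set E, E `<=` p.2 `|` U p.1 &
        polar f (E `|` U p.1.+1) `&` F = set0].
  have [h|h] := pselect (polar f (p.2 `|` U p.1) `&` F = set0).
    by have [E HE] := polar_finite_step Fk (Unbhs p.1.+1) h; exists E.
  by exists set0.
have [step stepP] := choice ex_step.
pose S := fix S n := if n is m.+1 then S m `|` step (m, S m) else set0.
have inv n : finite_set (S n) /\ polar f (S n `|` U n) `&` F = set0.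
  elim: n => [|n [fS IH]].
    split; first exact: finite_set0.
    (* The start uses that [U 0] is the whole group, whose polar is [f] alone. *)
    rewrite /= set0U U0 polar_setT; apply/seteqP; split=> // g [-> //].
  have [fE _ H] := stepP (n, S n) IH; split; first by rewrite finite_setU.
  apply/seteqP; split=> // g [gp gF].
  suff : (polar f (step (n, S n) `|` U n.+1) `&` F) g by rewrite H.
  by split=> // x [xs|xU]; apply: gp; [left; right|right].
have Smono m n : (m <= n)%N -> S m `<=` S n.
  move=> /subnK <-; elim: (n - m)%N => [|k IH] // x /IH Sx.
  by rewrite addSn; left.
have Umono m n : (m <= n)%N -> U n `<=` U m.
  move=> /subnK <-; elim: (n - m)%N => [|k IH] // x.
  by rewrite addSn => /Udec/IH.
(* Points outside [S m] are added at stage [m] or later, hence come from [U m]. So [K] has only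
   finitely many points outside each neighbourhood of [0]. *)
have SU m n : S n `<=` S m `|` U m.
  elim: n => [|n IH] // x Sx.
  have [mn|nm] := leqP m n; last by left; exact: Smono Sx.
  have [_ H _] := stepP (n, S n) (inv n).2.
  by case: Sx => [/IH //|/H[/IH //|/= Ux]]; right; exact: Umono Ux.
pose K := [set 0] `|` \bigcup_n S n.
have KN : nbhs f (polar f K).
  apply: polar_null_nbhs; first by left.
  move=> V V0; have [n UV] := Ubase V V0.
  apply: sub_finite_set (inv n).1 => x [[->|[m _ Sx]] nVx].
    by case: nVx; exact: nbhs_singleton.
  by have [//|/UV] := SU n m x Sx.
apply: filterS KN => g gK Fg; have [n gn] := char_in_polar f g Ubase.
have [_ H] := inv n; suff : (polar f (S n `|` U n) `&` F) g by rewrite H.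
split=> // x [Sx|Ux]; last exact: gn.
by apply: gK; right; exists n.
Qed.

End BanachDieudonne.

Theorem mainTheorem10 (R : realType) (A : topologicalZmodType) :
  metrizable R A -> k_space (dual R A).
Proof.
move=> [d [d0 deq dC dtri dnbhs]]; split; first exact: dual_hausdorff.
move=> F Fk; rewrite -openC openE => f nFf.
(* The balls of radius [1 / n], written without division so that [U 0] is the whole group. *)
pose U (n : nat) : set A := [set x | n%:R * d 0 x < 1].
apply: (@compactly_closed_nbhs R A f F U) => //.
- by apply/seteqP; split=> // x _; rewrite /U /= mul0r.
- move=> n; apply/dnbhs; exists n.+1%:R^-1; first by rewrite invr_gt0.
  move=> x /=; rewrite /U /= -[n.+1%:R^-1]mul1r ltr_pdivlMr // mulrC.
  by apply: le_lt_trans; rewrite ler_wpM2r // ler_nat.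
- move=> n x; rewrite /U /=; apply: le_lt_trans.
  by rewrite ler_wpM2r // ler_nat.
- move=> V /dnbhs[e e0 eV]; exists (Num.Def.archi_bound e^-1) => x; rewrite /U /=.
  set n := Num.Def.archi_bound _ => hx; apply: eV => /=.
  have h : e^-1 < n%:R.
    by apply: Num.Theory.archi_boundP; rewrite invr_ge0 ltW.
  rewrite ltNge; apply/negP => ex; move: hx; apply/negP; rewrite -leNgt.
  have : e^-1 * e <= n%:R * d 0 x by apply: ler_pM; rewrite ?invr_ge0 // ltW.
  by rewrite mulVf // lt0r_neq0.
Qed.
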